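(* Let $1\le p\le\infty$ and assume $M_g>0$. A traced state $([u],u_a,u_b)\in L_g^p([a,b))\times\mathbb F^2$ admits a representative $U\in\mathcal W_g^{1,p}([a,b])$ (i.e. $U=u$ $\mu_g$-a.e., $U(a)=u_a$, $U(b)=u_b$) if and only if there exists $v\in L_g^p([a,b))$ such that $$\int_{[a,b)}u\,D_g\varphi\,d\mu_g+\int_{[a,b)}v\,S_g\varphi\,d\mu_g=u_b\varphi(b)-u_a\varphi(a)\qquad\text{for all }\varphi\in\mathcal T_g .$$ In this case, $U$ and $v=D_gU$ are unique under the prescribed traces.
   Context: Let $\mathbb F$ be $\mathbb R$ or $\mathbb C$, let $a<b$ be real, and let $g:[a,b]\to\mathbb R$ be nondecreasing and left-continuous. $\mu_g$ is the finite Lebesgue--Stieltjes measure on $[a,b)$ with $\mu_g([s,t))=g(t)-g(s)$ for $a\le s\le t\le b$, and $M_g:=\mu_g([a,b))=g(b)-g(a)$. For $1\le p\le\infty$, $L_g^p([a,b))$ is the $L^p$ space of $\mathbb F$-valued functions for the completion of $\mu_g$ (modulo $\mu_g$-a.e. equality); $[u]$ denotes the class of $u$. $J_g:=\{t\in[a,b):\Delta g(t):=g(t^+)-g(t)>0\}$ is the set of jump points, so $\mu_g(\{t\})=\Delta g(t)$ for $t\in J_g$. $AC_g([a,b])$ is the set of $u:[a,b]\to\mathbb F$ such that for every $\varepsilon>0$ there is $\delta>0$ such that, for every finite family of pairwise disjoint intervals $[a_j,b_j)\subset[a,b)$, $\sum_j(g(b_j)-g(a_j))<\delta$ implies $\sum_j|u(b_j)-u(a_j)|<\varepsilon$.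 It is known that $u\in AC_g([a,b])$ if and only if there is $v\in L_g^1([a,b))$ with $u(t)=u(a)+\int_{[a,t)}v\,d\mu_g$ for all $t\in[a,b]$; $v$ is unique $\mu_g$-a.e. and the Stieltjes derivative is $D_gu:=v$. $\mathcal W_g^{1,p}([a,b]):=\{U\in AC_g([a,b]): U|_{[a,b)}\in L_g^p([a,b)),\ D_gU\in L_g^p([a,b))\}$. Posterior trace: for $u\in AC_g([a,b])$, $S_gu(t):=u(t^+)$ if $t\in J_g$ and $S_gu(t):=u(t)$ if $t\notin J_g$. Test space: $\mathcal T_g$ is the set of functions $\varphi:[a,b]\to\mathbb F$ of the form $\varphi(t)=c+\int_{[a,t)}\psi\,d\mu_g$ with $c\in\mathbb F$ and $\psi\in L_g^\infty([a,b))$ (so $D_g\varphi=\psi$). *)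

(* Defs.v *)
From HB Require Import structures.
From mathcomp Require Import all_boot all_order all_algebra.
From mathcomp Require Import all_classical all_reals all_analysis.
From mathcomp Require Import complex.
From mathcomp Require Import ring lra.

Set Implicit Arguments.
Unset Strict Implicit.
Unset Printing Implicit Defensive.

Import Order.TTheory GRing.Theory Num.Theory.
Import numFieldNormedType.Exports.

Local Open Scope classical_set_scope.
Local Open Scope ring_scope.

Inductive scalar_kind := RealScalars | ComplexScalars.

Definition scalar_field (R : realType) (k : scalar_kind) : numFieldType :=
  match k with
  | RealScalars => R
  | ComplexScalars => R[i]
  end.

Section scalars.
Context {R : realType}.

Definition re (k : scalar_kind) : scalar_field R k -> R :=
  match k with
  | RealScalars => fun z => z
  | ComplexScalars => fun z => complex.Re z
  end.

Definition im (k : scalar_kind) : scalar_field R k -> R :=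
  match k with
  | RealScalars => fun=> 0
  | ComplexScalars => fun z => complex.Im z
  end.

(* [x + iy]; in the real case the imaginary part, always 0 here, is dropped. *)
Definition of_parts (k : scalar_kind) : R -> R -> scalar_field R k :=
  match k with
  | RealScalars => fun x _ => x
  | ComplexScalars => fun x y => (x +i* y)%C
  end.

(* [`|z|] lives in the scalar field itself; its real part is the modulus in R. *)
Definition modulus (k : scalar_kind) (z : scalar_field R k) : R := re `|z|.

End scalars.

(* A function on [a, b] is represented by a total function on R of which only
   the values on [a, b] are ever used. *)
Record integrator (R : realType) (a b : R) := Integrator {
  integrator_fun :> R -> R ;
  integrator_nondecreasing :
    {in `[a, b] &, {homo integrator_fun : s t / s <= t}} ;
  integrator_left_continuous :
    forall t, t \in `]a, b] -> integrator_fun x @[x --> t^'-] --> integrator_fun t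
}.

Section stieltjes_measure.
Context {R : realType} {a b : R}.
Implicit Type g : integrator a b.

Definition extend g (t : R) : R := g (Num.max a (Num.min t b)).

(* [extend g] is constant on each side of [a, b], so no mass sits outside
   [a, b[.  The library's Lebesgue-Stieltjes measures are built from
   right-continuous functions; t |-> g(t+) yields the measure that gives
   [s, t[ the mass g t - g s, see [stieltjes_itv]. *)
Definition right_version g (t : R) : R := inf [set extend g s | s in `]t, +oo[].


Lemma clamp_itv (x : R) : a <= b -> Num.max a (Num.min x b) \in `[a, b].
Proof. by move=> ab; rewrite in_itv/= le_max lexx/= ge_max ab ge_min lexx orbT. Qed.

Lemma extend_nondecreasing g : nondecreasing_fun (extend g).
Proof.
move=> x y xy; rewrite /extend; have [ab|ba] := leP a b.
  apply: integrator_nondecreasing; [exact: clamp_itv..|].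
  by rewrite ge_max le_max lexx/= le_max le_min !ge_min xy lexx !orbT.
have e z : Num.max a (Num.min z b) = a.
  by apply/max_idPl; rewrite ge_min (ltW ba) orbT.
by rewrite !e.
Qed.

Lemma extend_lbound g (t : R) :
  has_lbound [set extend g s | s in `]t, +oo[].
Proof.
exists (extend g t) => _ [s /= ts <-]; apply: extend_nondecreasing.
by move: ts; rewrite in_itv/= andbT => /ltW.
Qed.

Lemma right_version_le g (t s : R) : t < s -> right_version g t <= extend g s.
Proof.
move=> ts; apply: ge_inf; first exact: extend_lbound.
by exists s => //=; rewrite in_itv/= ts.
Qed.

Lemma le_right_version g (t s : R) : t <= s -> extend g t <= right_version g s.
Proof.
move=> ts; apply: lb_le_inf.
  by exists (extend g (s + 1)), (s + 1) => //=; rewrite in_itv/= ltrDl ltr01.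
move=> _ [x /= sx <-]; apply: extend_nondecreasing.
by move: sx; rewrite in_itv/= andbT => /ltW; exact: le_trans.
Qed.

Lemma right_version_nondecreasing g : nondecreasing_fun (right_version g).
Proof.
move=> x y; rewrite le_eqVlt => /predU1P[->//|xy].
exact: le_trans (right_version_le g xy) (le_right_version g (lexx y)).
Qed.

Lemma right_version_right_continuous g : right_continuous (right_version g).
Proof.
move=> x; apply/cvgrPdist_lt => e e0.
have : has_inf [set extend g s | s in `]x, +oo[].
  split; last exact: extend_lbound.
  by exists (extend g (x + 1)), (x + 1) => //=; rewrite in_itv/= ltrDl ltr01.
move=> /(@inf_adherent _ _ e e0)[_ [s /= xs <-] gs].
have {}xs : x < s by move: xs; rewrite in_itv/= andbT.
near=> y.
have xy : x < y by near: y; exact: nbhs_right_gt.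
have ys : y < s by near: y; exact: nbhs_right_lt.
rewrite distrC ger0_norm ?subr_ge0; last exact/right_version_nondecreasing/ltW.
by rewrite ltrBlDl (le_lt_trans (right_version_le g ys)).
Unshelve. all: by end_near. Qed.

HB.instance Definition _ g := isCumulative.Build R _ R (right_version g)
  (@right_version_nondecreasing g) (@right_version_right_continuous g).

(* The real line with the sigma-algebra of the completion of mu_g. *)
Definition stieltjes_space g : measurableType _ :=
  caratheodory_type ((wlength (right_version g))^*)%mu.

Definition stieltjes g : {measure set (stieltjes_space g) -> \bar R} :=
  completed_lebesgue_stieltjes_measure (right_version g).


Lemma extend_left_continuous g (t : R) : extend g s @[s --> t^'-] --> extend g t.
Proof.
have [ta|at_] := leP t a.
  have e s : s <= a -> extend g s = g a.
    by move=> sa; rewrite /extend; congr (g _); apply/max_idPl; rewrite ge_min sa.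
  rewrite (e _ ta); apply: cvg_near_cst; near=> s; apply: e.
  by rewrite (le_trans _ ta)//; near: s; exact: nbhs_left_le.
have [ab|ba] := ltP b a.
  have e s : extend g s = g a.
    by rewrite /extend; congr (g _); apply/max_idPl; rewrite ge_min (ltW ab) orbT.
  by rewrite e; apply: cvg_near_cst; near=> s; exact: e.
have [tb|bt] := leP t b; last first.
  have e s : b <= s -> extend g s = g b.
    by move=> sa; rewrite /extend (min_idPr sa) (max_idPr ba).
  rewrite (e _ (ltW bt)); apply: cvg_near_cst; near=> s; apply: e.
  by near: s; exact: nbhs_left_ge.
have e s : a <= s <= b -> extend g s = g s.
  by case/andP=> sa sb; rewrite /extend (min_idPl sb) (max_idPr sa).
rewrite e ?(ltW at_)//; apply: cvg_trans (@integrator_left_continuous _ _ _ g t _); last first.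
  by rewrite in_itv/= at_ tb.
apply: near_eq_cvg; near=> s; rewrite e//; apply/andP; split.
  by near: s; exact: nbhs_left_ge.
by rewrite (le_trans _ tb)//; near: s; exact: nbhs_left_le.
Unshelve. all: by end_near. Qed.

Lemma measurable_stieltjes_itv g (i : interval R) :
  measurable ([set` i] : set (stieltjes_space g)).
Proof.
apply: sub_caratheodory; exact: (measurable_itv i).
Qed.

Lemma stieltjes_itv_oc g (s t : R) : s <= t ->
  stieltjes g `]s, t]%classic = (right_version g t - right_version g s)%:E.
Proof.
move=> st; rewrite -(wlength_itv_bnd (right_version g) false false st).
exact: measurable_mu_extE (is_ocitv s t).
Qed.

Lemma stieltjes_itv_oo g (s t : R) : s < t ->
  stieltjes g `]s, t[%classic = (extend g t - right_version g s)%:E.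
Proof.
move=> st.
pose z := fun n => t - (t - s) / n.+2%:R.
have zt n : z n < t by rewrite /z ltrBlDr ltrDl divr_gt0// subr_gt0.
have sz n : s <= z n.
  rewrite /z lerBrDr -lerBrDl ler_pdivrMr// ler_peMr ?subr_ge0 ?(ltW st)//.
  by rewrite ler1n.
have zc : z n @[n --> \oo] --> t.
  rewrite -[X in _ --> X]subr0; apply: cvgB; first exact: cvg_cst.
  rewrite -(mulr0 (t - s)); apply: cvgM; first exact: cvg_cst.
  by have := @cvg_harmonic R; rewrite -(cvg_shiftS (@harmonic R)).
pose F : (set (stieltjes_space g))^nat := fun n => `]s, z n]%classic.
have mF : stieltjes g (F n) @[n --> \oo] --> (extend g t - right_version g s)%:E.
  under eq_fun do rewrite /F stieltjes_itv_oc//.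
  apply: cvg_EFin; first exact: nearW.
  apply: cvgB; last exact: cvg_cst.
  apply: (@squeeze_cvgr _ _ _ _ (fun n => extend g (z n)) (fun=> extend g t)).
  - by apply: nearW => n; rewrite le_right_version//= right_version_le.
  - move/cvg_at_leftP : (@extend_left_continuous g t); apply.
    by split.
  - exact: cvg_cst.
have UF : \bigcup_n F n = `]s, t[%classic.
  apply/seteqP; split=> [x [n _]|x]; rewrite /F/= !in_itv/= => /andP[sx xz].
    by rewrite sx (le_lt_trans xz).
  have [n _ /(_ n (leqnn n)) xn] : \forall n \near \oo, x < z n by apply: (cvgr_gt t).
  by exists n => //=; rewrite in_itv/= sx ltW.
suff : stieltjes g (F n) @[n --> \oo] --> stieltjes g `]s, t[%classic.
  by move=> h; exact: (cvg_unique _ h mF).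
rewrite -UF; apply: nondecreasing_cvg_mu.
- by move=> n; exact: measurable_stieltjes_itv.
- by apply: bigcupT_measurable => n; exact: measurable_stieltjes_itv.
- move=> m n mn; apply/subsetPset => x; rewrite /F/= !in_itv/= => /andP[-> xm]/=.
  rewrite (le_trans xm)// lerD2l lerN2 ler_wpM2l ?subr_ge0 ?(ltW st)//.
  by rewrite lef_pV2 ?posrE// ler_nat.
Qed.

Lemma stieltjes_itv g (s t : R) : a <= s -> s <= t -> t <= b ->
  stieltjes g `[s, t[%classic = (g t - g s)%:E.
Proof.
move=> as_ st tb.
have e x : a <= x <= b -> extend g x = g x.
  by case/andP=> sa sb; rewrite /extend (min_idPl sb) (max_idPr sa).
have [->|] := eqVneq s t; first by rewrite set_itvxx measure0 subrr.
move=> nst; have {nst}st : s < t by rewrite lt_neqAle nst.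
have s1 : s - 1 < s by rewrite ltrBlDr ltrDl.
have := stieltjes_itv_oo g (lt_trans s1 st).
rewrite (@itv_bndbnd_setU _ _ _ (BLeft s)) ?bnd_simp//; last exact: ltW.
rewrite measureU/=; [|exact: measurable_stieltjes_itv..|]; last first.
  rewrite -subset0 => x/=; rewrite !in_itv/= => -[/andP[_ xs] /andP[sx _]].
  by move: xs; rewrite ltNge sx.
rewrite stieltjes_itv_oo// addeC !e ?as_ ?(ltW st)//; [|lra..].
move=> /(congr1 (fun x => x - (g s - right_version g (s - 1))%:E))%E.
by rewrite addeK// => ->; rewrite -EFinB; congr EFin; ring.
Qed.

End stieltjes_measure.

Section function_spaces.
Context {R : realType} {a b : R} (g : integrator a b) {k : scalar_kind}.
Local Notation mu := (stieltjes g).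
Local Notation K := (scalar_field R k).
Implicit Types (u v phi psi U : R -> K) (p : \bar R).

Definition scalar_integral (D : set R) u : K :=
  of_parts k (Rintegral mu D (fun t => re (u t)))
             (Rintegral mu D (fun t => im (u t))).

Definition Lp p u : Prop :=
  [/\ measurable_fun (`[a, b[%classic : set (stieltjes_space g))
        (fun t => re (u t)),
      measurable_fun (`[a, b[%classic : set (stieltjes_space g))
        (fun t => im (u t)) &
      (Lnorm mu p ((fun t => (modulus (u t))%:E) \_ `[a, b[%classic) < +oo)%E].

(* Equality in L^p, that is, of classes. *)
Definition ae_equal u v : Prop := ae_eq mu `[a, b[%classic u v.

Definition AC u : Prop :=
  forall eps : R, 0 < eps -> exists2 delta : R, 0 < delta &
    forall (n : nat) (s t : 'I_n -> R),
      (forall j, [/\ a <= s j, s j < t j & t j <= b]) ->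
      trivIset setT (fun j => `[s j, t j[%classic) ->
      \sum_(j < n) (g (t j) - g (s j)) < delta ->
      \sum_(j < n) modulus (u (t j) - u (s j)) < eps.

(* D_g u = v.  The derivative is only defined mu_g-a.e., whence a relation
   between u and the representatives v. *)
Definition is_stieltjes_derivative u v : Prop :=
  Lp 1%E v /\
  {in `[a, b], forall t, u t = u a + scalar_integral `[a, t[%classic v}.

Definition sobolev p U : Prop :=
  [/\ AC U, Lp p U &
      exists2 v, is_stieltjes_derivative U v & Lp p v].

Definition jump (t : R) : R := lim (g s @[s --> t^'+]) - g t.

Definition jump_set : set R := [set t | a <= t < b /\ 0 < jump t].

Definition posterior_trace u (t : R) : K :=
  if t \in jump_set then lim (u s @[s --> t^'+]) else u t.

Definition test_function phi : Prop :=
  exists c : K, exists2 psi, Lp +oo%E psi &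
    {in `[a, b], forall t, phi t = c + scalar_integral `[a, t[%classic psi}.

Definition total_mass : \bar R := mu `[a, b[%classic.

(* U represents the traced state ([u], ua, ub). *)
Definition represents p u (ua ub : K) U : Prop :=
  [/\ sobolev p U, ae_equal U u, U a = ua & U b = ub].

Definition weak_derivative u (ua ub : K) v : Prop :=
  forall phi psi, test_function phi -> is_stieltjes_derivative phi psi ->
    scalar_integral `[a, b[%classic (fun t => u t * psi t) +
    scalar_integral `[a, b[%classic (fun t => v t * posterior_trace phi t) =
    ub * phi b - ua * phi a.

End function_spaces.

(* Main.v *)
(* Write I f for the indefinite integral of f over [a, t[ and I+ f for the one
   over [a, t].  The integral of f(x) h(y) over the square [a, b[^2 splits into
   the regions x < y and y <= x, so Fubini's theorem gives the Stieltjes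
   integration by parts
     int (I f) h + int f (I+ h) = I f (b) I h (b),
   and the posterior trace of I h is exactly I+ h.  Hence a function U with
   derivative v satisfies the weak identity.  Conversely, given the weak
   identity for v, compare it with integration by parts for U := ua + I v:
   phi = 1 yields U b = ub, and then D_g phi = 1_E for arbitrary measurable E
   yields U = u almost everywhere.  For uniqueness, let w be the difference of
   two weak derivatives: I w vanishes almost everywhere and at b, hence
   everywhere, so w integrates to 0 over every [a, t[ and w = 0 a.e. *)
Require Import Defs.
From mathcomp Require Import all_boot all_order all_algebra.
From mathcomp Require Import all_classical all_reals all_analysis.
From mathcomp Require Import measurable_realfun ess_sup_inf.
From mathcomp Require Import complex ring.

Import Order.TTheory GRing.Theory Num.Theory.
Import numFieldNormedType.Exports.

Local Open Scope classical_set_scope.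
Local Open Scope ring_scope.

Set Implicit Arguments.
Unset Strict Implicit.

(** * Fubini's theorem on the sections of a measurable set *)

Section fubini_indicator.
Context {d} {X : measurableType d} {R : realType}.
Context (m : {sigma_finite_measure set X -> \bar R}).
Implicit Types (f h : X -> R) (E : set (X * X)).

(** The integral over a section is [fine] of the difference of two Tonelli integrals, of the
    positive and the negative part of h(y) times the indicator of [E]. Each is measurable in [x],
    and so are their difference and its image under [fine]. *)
Lemma measurable_Rintegral_xsection h E :
  measurable_fun setT h -> measurable E ->
  measurable_fun setT (fun x => \int[m]_(y in xsection E x) h y).
Proof.
move=> mh mE; pose k (z : X * X) : \bar R := (h z.2 * \1_E z)%:E.
have mk : measurable_fun [set: X * X] k.
  apply/measurable_EFinP; apply: measurable_funM; last exact: measurable_indic.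
  by apply: measurableT_comp.
apply: (eq_measurable_fun (fun x => fine (\int[m]_y k^\+ (x, y) - \int[m]_y k^\- (x, y))%E)).
  move=> x _; rewrite Rintegral_mkcond /Rintegral; congr fine.
  have -> : (\int[m]_y (h \_ (xsection E x) y)%:E = \int[m]_y k (x, y))%E.
    apply: eq_integral => y _; rewrite /k/= indicE patchE mem_xsection.
    by case: ifPn => _; rewrite ?mulr1 ?mulr0.
  rewrite [RHS]integralE -[fun y => k (x, y)]/(k \o pair x).
  by rewrite (funepos_comp k (pair x)) (funeneg_comp k (pair x)).
apply: (measurableT_comp (fine_measurable measurableT)).
apply: emeasurable_funB.
  by apply: measurable_fun_fubini_tonelli_F => //; exact: measurable_funepos.
by apply: measurable_fun_fubini_tonelli_F => //; exact: measurable_funeneg.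
Qed.

(** Both sides are iterated integrals of the kernel [k], equal to f(x) h(y) on [E] and to 0
    elsewhere; it is integrable because |f(x)| |h(y)| dominates it. *)
Lemma Rintegral_section_exchange f h E :
  m.-integrable setT (EFin \o f) -> m.-integrable setT (EFin \o h) ->
  measurable E ->
  \int[m]_y (\int[m]_(x in ysection E y) f x * h y) =
  \int[m]_x (f x * \int[m]_(y in xsection E x) h y).
Proof.
move=> intf inth mE; pose k (z : X * X) : \bar R := (f z.1 * h z.2 * \1_E z)%:E.
have mk : measurable_fun [set: X * X] k.
  apply/measurable_EFinP; apply: measurable_funM; last exact: measurable_indic.
  apply: measurable_funM; apply: measurableT_comp => //.
    exact/measurable_EFinP/(measurable_int m).
  exact/measurable_EFinP/(measurable_int m).
have /integrableP[mf foo] := intf; have /integrableP[mh hoo] := inth.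
have hfin : (\int[m]_y `|(h y)%:E|)%E \is a fin_num.
  by rewrite ge0_fin_numE// integral_ge0.
have intk : (m \x m)%E.-integrable setT k.
  apply/integrable12ltyP => //.
  apply: (@le_lt_trans _ _ (\int[m]_x (`|(f x)%:E| * \int[m]_y `|(h y)%:E|))%E).
    apply: ge0_le_integral => //.
    - by move=> x _; exact: integral_ge0.
    - apply: (measurable_fun_fubini_tonelli_F (abse \o k)) => //.
      exact: measurableT_comp.
    - by move=> z; exact: abse_ge0.
    - by apply: emeasurable_funM => //; exact: measurableT_comp.
    - move=> x _; rewrite -ge0_integralZl//; last exact: measurableT_comp.
      apply: ge0_le_integral => //.
      + apply: measurableT_comp => //.
        exact: (measurableT_comp mk (pair1_measurable x)).
      + by apply: emeasurable_funM => //; exact: measurableT_comp.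
      + move=> y _; rewrite /k/= -EFinM lee_fin !normrM ler_piMr ?mulr_ge0//.
        by rewrite ger0_norm ?indic_le1// indicE.
  rewrite ge0_integralZr//; [|exact: measurableT_comp|exact: integral_ge0].
  by rewrite lte_mul_pinfty//; [exact: integral_ge0 | rewrite ge0_fin_numE// integral_ge0].
(* Integrability on each section makes the inner integrals finite, so [fine] loses nothing and the
   constant factor comes out. *)
have inner1 y : (\int[m]_x k (x, y) = (\int[m]_(x in ysection E y) f x * h y)%R%:E)%E.
  have iy : m.-integrable (ysection E y) (EFin \o f).
    by apply: integrableS intf => //; exact: measurable_ysection.
  rewrite mulrC EFinM /Rintegral fineK ?integrable_fin_num//; last first.
    exact: measurable_ysection.
  rewrite -integralZl//; last exact: measurable_ysection.
  rewrite [RHS]integral_mkcond; apply: eq_integral => x _.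
  rewrite /k/= indicE patchE mem_ysection -EFinM.
  by case: ifPn => _; rewrite ?mulr1 ?mulr0 1?mulrC.
have inner2 x : (\int[m]_y k (x, y) = (f x * \int[m]_(y in xsection E x) h y)%R%:E)%E.
  have ix : m.-integrable (xsection E x) (EFin \o h).
    by apply: integrableS inth => //; exact: measurable_xsection.
  rewrite EFinM /Rintegral fineK ?integrable_fin_num//; last first.
    exact: measurable_xsection.
  rewrite -integralZl//; last exact: measurable_xsection.
  rewrite [RHS]integral_mkcond; apply: eq_integral => y _.
  rewrite /k/= indicE patchE mem_xsection -EFinM.
  by case: ifPn => _; rewrite ?mulr1 ?mulr0.
rewrite /Rintegral/=; congr fine.
under eq_integral do rewrite -inner1.
under [RHS]eq_integral do rewrite -inner2.
by rewrite -Fubini.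
Qed.

End fubini_indicator.

(** * Indefinite Stieltjes integrals *)

Section primitive.
Context {R : realType} {a b : R} (g : integrator a b).
Local Notation T := (stieltjes_space g).
Local Notation mu := (stieltjes g).
Local Notation D := (`[a, b[%classic : set R).
Local Notation integrableD f := (mu.-integrable D (EFin \o f)).
Implicit Types (f h w : R -> R) (s t x : R) (A : set R).

(** [extend g] stays between g(a) and g(b), so each ]-n, n] has mass at most g(b) - g(a), and
    continuity from below carries the bound to the whole line. *)
Lemma stieltjes_setT_fin : a <= b -> mu setT \is a fin_num.
Proof.
move=> ab; have ge0 : (0 <= mu setT)%E by [].
rewrite ge0_fin_numE//.
pose F n : set T := `](- n%:R), n%:R]%classic.
have mF n : measurable (F n) by exact: measurable_stieltjes_itv.
have UF : \bigcup_n F n = setT.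
  rewrite -subTset => x _; have xn := Num.Theory.archi_boundP (normr_ge0 (x : R)).
  exists (Num.bound `|(x : R)|) => //; rewrite /F/= in_itv/=.
  by move: xn; rewrite ltr_norml => /andP[-> /ltW].
have ndF : nondecreasing_seq F.
  move=> i j ij; apply/subsetPset => x; rewrite /F/= !in_itv/= => /andP[ix xi].
  by rewrite (le_lt_trans _ ix) ?lerN2 ?ler_nat// (le_trans xi)// ler_nat.
have := @nondecreasing_cvg_mu _ _ _ mu F mF (bigcupT_measurable F mF) ndF.
rewrite UF => cF; apply: (@le_lt_trans _ _ (g b - g a)%:E); last exact: ltry.
have ga x : g a <= extend g x.
  apply: integrator_nondecreasing; last by rewrite le_max lexx.
    by rewrite in_itv/= lexx.
  exact: clamp_itv.
have gb x : extend g x <= g b.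
  apply: integrator_nondecreasing; first exact: clamp_itv.
    by rewrite in_itv/= lexx andbT.
  by rewrite ge_max ab ge_min lexx orbT.
rewrite -(cvg_lim _ cF)//; apply: lime_le; first by apply/cvg_ex; eexists; exact: cF.
apply: nearW => n /=; rewrite /F stieltjes_itv_oc.
  rewrite lee_fin lerB//.
    by apply: le_trans (gb (n%:R + 1)); apply: right_version_le; rewrite ltrDl.
  by apply: le_trans (ga (- n%:R)) _; exact: le_right_version.
by rewrite lerNl (le_trans _ (ler0n _ n))// oppr_le0.
Qed.

Definition prim f t : R := Rintegral mu `[a, t[%classic f.
(** For integrable [f] and a <= t < b this is the right limit of [prim f] at [t], which is how the
    posterior trace of a primitive is computed. *)
Definition primr f t : R := Rintegral mu `[a, t]%classic f.

Lemma sub_integrableD f (i : interval R) : integrableD f ->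
  [set` i] `<=` D -> mu.-integrable [set` i] (EFin \o f).
Proof. by move=> intf iD; apply: integrableS intf => //; exact: measurable_stieltjes_itv. Qed.

Lemma itv_subD (s t : itv_bound R) : (BLeft a <= s)%O -> (t <= BLeft b)%O ->
  [set` Interval s t] `<=` D.
Proof. by move=> as_ tb; apply: subset_itv. Qed.

Lemma prim_sub f s t : integrableD f -> a <= s -> s <= t -> t <= b ->
  prim f t - prim f s = Rintegral mu `[s, t[%classic f.
Proof.
move=> intf as_ st tb; rewrite /prim.
rewrite (@itv_bndbnd_setU _ _ (BLeft a) (BLeft s)) ?bnd_simp//.
rewrite Rintegral_setU/=; [|exact: measurable_stieltjes_itv..| |].
- by rewrite addrC addKr.
- rewrite -itv_bndbnd_setU ?bnd_simp//; apply: sub_integrableD => //.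
  by apply: itv_subD; rewrite ?bnd_simp.
- apply/disj_setPS => y [/=]; rewrite !in_itv/= => /andP[_ ys] /andP[sy _].
  by move: ys; rewrite ltNge sy.
Qed.

Lemma prim_subr f t x : integrableD f -> a <= t -> t < x -> x <= b ->
  prim f x - primr f t = Rintegral mu `]t, x[%classic f.
Proof.
move=> intf at_ tx xb; rewrite /prim /primr.
rewrite (@itv_bndbnd_setU _ _ (BLeft a) (BRight t)) ?bnd_simp//.
rewrite Rintegral_setU/=; [|exact: measurable_stieltjes_itv..| |].
- by rewrite addrC addKr.
- rewrite -itv_bndbnd_setU ?bnd_simp//; apply: sub_integrableD => //.
  by apply: itv_subD; rewrite ?bnd_simp.
- apply/disj_setPS => y [/=]; rewrite !in_itv/= => /andP[_ ys] /andP[sy _].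
  by move: ys; rewrite leNgt sy.
Qed.

(** The extra endpoint is a null set; this is the situation off the jump set. *)
Lemma primr_prim f t : integrableD f -> a <= t -> t < b ->
  mu [set t] = 0 -> primr f t = prim f t.
Proof.
move=> intf at_ tb mut; rewrite /prim /primr -(@setUitv1 _ _ _ _ true) ?bnd_simp//.
have mt : measurable ([set t] : set T).
  by rewrite -set_itv1; exact: measurable_stieltjes_itv.
have it : mu.-integrable [set t] (EFin \o f).
  rewrite -set_itv1; apply: sub_integrableD => //.
  by apply: itv_subD; rewrite bnd_simp.
rewrite Rintegral_setU/=; [|exact: measurable_stieltjes_itv|exact: mt| |].
- rewrite [X in _ + X](_ : _ = 0) ?addr0// /Rintegral null_set_integral//.
  by apply: (@measurable_int _ _ _ mu); exact: it.
- rewrite setUitv1 ?bnd_simp//; apply: sub_integrableD => //.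
  by apply: itv_subD; rewrite ?bnd_simp.
- by apply/disj_setPS => y [/=]; rewrite !in_itv/= => /andP[_ /[swap] ->]; rewrite ltxx.
Qed.

(** Absolute continuity of the integral, applied to the extension of [f] by 0, which is integrable
    on the whole line and agrees with [f] on subsets of [D]. *)
Lemma integralD_abs_continuous f (e : R) : integrableD f -> 0 < e ->
  exists2 d : R, 0 < d & forall A, A `<=` D -> measurable (A : set T) ->
    (mu A < d%:E)%E -> Rintegral mu A (fun x => `|f x|) < e.
Proof.
move=> intf e0; have mD := measurable_stieltjes_itv g `[a, b[.
have : mu.-integrable setT (EFin \o (f \_ D)).
  rewrite -restrict_EFin; apply/(integrable_mkcond _ mD); exact: intf.
move=> /integral_normr_continuous /(_ e e0)[d [d0 dA]]; exists d => // A AD mA muA.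
rewrite (_ : Rintegral _ _ _ = Rintegral mu A (fun x => `|(f \_ D) x|)); first exact: dA.
by apply: eq_Rintegral => x /set_mem/AD xD; rewrite patchE mem_set.
Qed.

(** The difference is an integral over ]t, x[, whose mass tends to 0 as x decreases to t because
    [right_version g] is right-continuous. *)
Lemma prim_cvg_right f t : integrableD f -> a <= t -> t < b ->
  prim f x @[x --> t^'+] --> primr f t.
Proof.
move=> intf at_ tb; apply/cvgrPdist_lt => e e0.
have [d d0 dA] := integralD_abs_continuous intf e0.
near=> x.
have tx : t < x by near: x; exact: nbhs_right_gt.
have xb : x <= b by near: x; exact: nbhs_right_le.
have sub : `]t, x[%classic `<=` D by apply: itv_subD; rewrite ?bnd_simp.
rewrite distrC prim_subr//.
apply: le_lt_trans (le_normr_Rintegral _ _) _.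
- exact: measurable_stieltjes_itv.
- exact: sub_integrableD.
- apply: dA => //; first exact: measurable_stieltjes_itv.
  rewrite stieltjes_itv_oo// lte_fin.
  apply: (@le_lt_trans _ _ (right_version g x - right_version g t)).
    by rewrite lerB// le_right_version.
  rewrite -[ltLHS]ger0_norm ?subr_ge0 ?right_version_nondecreasing ?ltW// distrC.
  near: x; have /cvgrPdist_lt := @right_version_right_continuous _ _ _ g t; exact.
Unshelve. all: by end_near. Qed.

End primitive.

(** * Measurability of primitives and Stieltjes integration by parts *)

Section primitive_by_parts.
Context {R : realType} {a b : R} (g : integrator a b).
Local Notation T := (stieltjes_space g).
Local Notation mu := (stieltjes g).
Local Notation D := (`[a, b[%classic : set R).
Local Notation integrableD f := (mu.-integrable D (EFin \o f)).
Implicit Types (f h w : R -> R) (s t x : R) (A : set R).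

(** Borel sets are Carathéodory measurable, which makes the order between two coordinates a
    measurable relation on the product. *)
Let measurable_idR : measurable_fun (setT : set T) (id : T -> R).
Proof. by move=> _ Y mY; rewrite setTI preimage_id; exact: sub_caratheodory. Qed.

(** The sections of [below] at [t] are the rays x < t and t < y. Its mirror image [above] turns the
    first ray into an x-section, the form in which measurability of section integrals is
    available. *)
Let below : set (T * T) := [set z | (z.1 : R) < (z.2 : R)].
Let above : set (T * T) := [set z | (z.2 : R) < (z.1 : R)].

Let measurable_1 : measurable_fun (setT : set (T * T)) (fun z => (z.1 : R)).
Proof. exact: (measurableT_comp measurable_idR measurable_fst). Qed.

Let measurable_2 : measurable_fun (setT : set (T * T)) (fun z => (z.2 : R)).
Proof. exact: (measurableT_comp measurable_idR measurable_snd). Qed.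

Let measurable_below : measurable below.
Proof.
have /(_ measurableT [set true] I) := measurable_fun_ltr measurable_1 measurable_2.
by rewrite setTI; congr measurable; apply/seteqP; split=> z //=.
Qed.

Let measurable_above : measurable above.
Proof.
have /(_ measurableT [set true] I) := measurable_fun_ltr measurable_2 measurable_1.
by rewrite setTI; congr measurable; apply/seteqP; split=> z //=.
Qed.

Let mD : measurable (D : set T) := measurable_stieltjes_itv g `[a, b[.

Let restrict_integrable f : integrableD f -> mu.-integrable setT (EFin \o (f \_ D)).
Proof.
by move=> intf; rewrite -restrict_EFin; apply/(integrable_mkcond _ mD); exact: intf.
Qed.

Let primE f t : t \in D -> Rintegral mu (ysection below t) (f \_ D) = prim g f t.
Proof.
rewrite inE/= in_itv/= => /andP[at_ tb]; rewrite -Rintegral_mkcondr; congr Rintegral.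
apply/seteqP; split=> x /=; rewrite in_itv/=.
  by move=> [/ysectionP/= xt]; rewrite in_itv/= => /andP[-> _].
move=> /andP[ax xt]; split; first exact/ysectionP.
by rewrite in_itv/= ax (lt_trans xt).
Qed.

(** The ray t < y meets [D] in the complement of [a, t]; this is where the closed primitive
    enters. *)
Let primrE f t : integrableD f -> t \in D ->
  Rintegral mu (xsection below t) (f \_ D) = prim g f b - primr g f t.
Proof.
rewrite inE/= in_itv/= => intf /andP[at_ tb].
rewrite prim_subr// -Rintegral_mkcondr; congr Rintegral.
apply/seteqP; split=> x /=; rewrite in_itv/=.
  by move=> [/xsectionP/= tx]; rewrite in_itv/= => /andP[_ ->]; rewrite andbT.
move=> /andP[tx xb]; split; first exact/xsectionP.
by rewrite in_itv/= xb andbT (le_trans at_)// ltW.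
Qed.

Let measurable_restrictD f : integrableD f -> measurable_fun (setT : set T) (f \_ D).
Proof.
move=> intf; apply/measurable_EFinP; apply: (@measurable_int _ _ _ mu).
exact: restrict_integrable.
Qed.

Lemma measurable_prim f : integrableD f -> measurable_fun (D : set T) (prim g f).
Proof.
move=> intf; apply: (@eq_measurable_fun _ _ T _ _ (fun t : T =>
   Rintegral mu (xsection above t) (f \_ D))).
  by move=> t tD; rewrite -[xsection above t]/(ysection below t) primE.
(* The measure is spelled out because a sigma-finite one is asked for, while [stieltjes g] is
   declared only as a measure. *)
have mx := @measurable_Rintegral_xsection _ T R
  (completed_lebesgue_stieltjes_measure (right_version g)) _ _
  (measurable_restrictD intf) measurable_above.
by apply: measurable_funTS; exact: mx.
Qed.

Lemma measurable_primr f : integrableD f -> measurable_fun (D : set T) (primr g f).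
Proof.
move=> intf; apply: (@eq_measurable_fun _ _ T _ _ (fun t : T =>
   prim g f b - Rintegral mu (xsection below t) (f \_ D))).
  by move=> t tD; rewrite primrE// subKr.
have mx := @measurable_Rintegral_xsection _ T R
  (completed_lebesgue_stieltjes_measure (right_version g)) _ _
  (measurable_restrictD intf) measurable_below.
apply: measurable_funB; first exact: measurable_cst.
apply: measurable_funTS; exact: mx.
Qed.

(** A bound uniform in the interval: it makes both primitives bounded factors, so that their
    products with integrable functions are integrable. *)
Lemma Rintegral_itv_bound f (i : interval R) : integrableD f -> [set` i] `<=` D ->
  `|Rintegral mu [set` i] f| <= Rintegral mu D (fun x => `|f x|).
Proof.
move=> intf sub; have mi := measurable_stieltjes_itv g i.
apply: le_trans (le_normr_Rintegral mi (sub_integrableD intf sub)) _.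
rewrite -(setIidr sub) Rintegral_mkcondr; apply: le_Rintegral => //.
- rewrite -restrict_EFin; apply/integrable_restrict => //.
  by rewrite (setIidr sub); exact: integrable_norm (sub_integrableD intf sub).
- exact: integrable_norm.
- move=> x _; rewrite patchE; case: ifPn => _; rewrite ?lexx ?normr_ge0 //.
Qed.

Lemma prim_bound f t : integrableD f -> t \in D ->
  `|prim g f t| <= Rintegral mu D (fun x => `|f x|).
Proof.
rewrite inE/= in_itv/= => intf /andP[at_ tb]; apply: Rintegral_itv_bound => //.
by apply: itv_subD; rewrite ?bnd_simp ?ltW.
Qed.

Lemma primr_bound f t : integrableD f -> t \in D ->
  `|primr g f t| <= Rintegral mu D (fun x => `|f x|).
Proof.
rewrite inE/= in_itv/= => intf /andP[at_ tb]; apply: Rintegral_itv_bound => //.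
by apply: itv_subD; rewrite ?bnd_simp.
Qed.

Lemma integrableD_mul_bounded f h (C : R) : integrableD f ->
  measurable_fun (D : set T) h -> (forall x, x \in D -> `|h x| <= C) ->
  integrableD (fun x => f x * h x).
Proof.
move=> intf mh hC.
have -> : EFin \o (fun x => f x * h x) = ((EFin \o f) \* (EFin \o h))%E by [].
apply: (integrableMl mD intf mh).
exists C; split; first exact: num_real.
by move=> y Cy x xD /=; apply: (le_trans _ (ltW Cy)); apply: hC; exact: mem_set.
Qed.

(** Integrating f(x) h(y) over x < y in both orders gives the first term on one side and
    [prim g h b] times the integral of [f], minus the second term, on the other. The diagonal lies
    outside this region, hence the asymmetry between [prim] and [primr]. *)
Lemma prim_by_parts f h : integrableD f -> integrableD h ->
  Rintegral mu D (fun x => prim g f x * h x) +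
  Rintegral mu D (fun x => f x * primr g h x) = prim g f b * prim g h b.
Proof.
move=> intf inth.
have := @Rintegral_section_exchange _ T R
  (completed_lebesgue_stieltjes_measure (right_version g)) (f \_ D) (h \_ D) below
  (restrict_integrable intf) (restrict_integrable inth) measurable_below.
have -> : Rintegral mu setT (fun y => Rintegral mu (ysection below y) (f \_ D) * (h \_ D) y)
   = Rintegral mu D (fun x => prim g f x * h x).
  rewrite [RHS]Rintegral_mkcond; apply: eq_Rintegral => x _; rewrite !patchE.
  by case: ifPn => xD; [rewrite primE | rewrite mulr0].
have -> : Rintegral mu setT (fun x => (f \_ D) x * Rintegral mu (xsection below x) (h \_ D))
   = Rintegral mu D (fun x => prim g h b * f x - f x * primr g h x).
  rewrite [RHS]Rintegral_mkcond; apply: eq_Rintegral => x _; rewrite !patchE.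
  case: ifPn => xD; last by rewrite mul0r.
  by rewrite primrE// mulrBr [_ * prim _ _ _]mulrC.
move=> ->; rewrite RintegralB//.
- by rewrite subrK RintegralZl// mulrC.
- have -> : EFin \o (fun x => prim g h b * f x) = (fun x => (prim g h b)%:E * (f x)%:E)%E by [].
  exact: integrableZl.
- apply: (integrableD_mul_bounded intf (measurable_primr inth)).
  by move=> x xD; exact: primr_bound.
Qed.

End primitive_by_parts.

(** * A primitive determines its integrand almost everywhere *)

Section primitive_uniqueness.
Context {R : realType} {a b : R} (ab : a <= b) (g : integrator a b).
Local Notation T := (stieltjes_space g).
Local Notation mu := (stieltjes g).
Local Notation D := (`[a, b[%classic : set R).
Local Notation integrableD f := (mu.-integrable D (EFin \o f)).
Implicit Types (f h w : R -> R) (s t x : R) (A : set R).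

Let mD : measurable (D : set T) := measurable_stieltjes_itv g `[a, b[.

(** Open rays are stable under intersection and generate the Borel sets; they start the Dynkin
    argument that follows. *)
Let ray_integral0 f x : (forall t, t \in `[a, b] -> prim g f t = 0) ->
  Rintegral mu `]-oo, x[%classic (f \_ D) = 0.
Proof.
move=> f0; rewrite -Rintegral_mkcondr.
have -> : `]-oo, x[%classic `&` D = `[a, Num.min x b[%classic.
  apply/seteqP; split=> y /=; rewrite !in_itv/= lt_min; first by case=> -> /andP[-> ->].
  by case/andP=> -> /andP[-> ->].
have [at_|ta] := leP a (Num.min x b).
  by apply: f0; rewrite in_itv/= at_ ge_min lexx orbT.
by rewrite set_itv_ge ?Rintegral_set0// -leNgt bnd_simp ltW.
Qed.

(** The Borel sets on which the integral vanishes form a Dynkin class containing the open rays.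
    Complements stay in the class because the total integral is the primitive at [b], which is 0. *)
Let borel_integral0 f : integrableD f ->
  (forall t, t \in `[a, b] -> prim g f t = 0) ->
  forall A, measurable (A : set (measurableTypeR R)) -> Rintegral mu A (f \_ D) = 0.
Proof.
move=> intf f0.
have int1 : mu.-integrable setT (EFin \o (f \_ D)).
  by rewrite -restrict_EFin; apply/(integrable_mkcond _ mD); exact: intf.
have mT A : measurable (A : set (measurableTypeR R)) -> measurable (A : set T).
  exact: sub_caratheodory.
have intA (A : set T) : measurable A -> mu.-integrable A (EFin \o (f \_ D)).
  by move=> mA; apply: integrableS int1.
have fullE : Rintegral mu setT (f \_ D) = 0.
  by rewrite -Rintegral_mkcond; apply: f0; rewrite in_itv/= ab lexx.
move=> A mA.
have GE : @measurable _ (measurableTypeR R) = <<s @RGenInftyO.G R >>.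
  exact: RGenInftyO.measurableE.
have sA : <<s @RGenInftyO.G R >> A by rewrite -GE.
refine (@dynkin_induction _ (measurableTypeR R) (@RGenInftyO.G R)
  (fun B => Rintegral mu B (f \_ D) = 0) _ _ _ _ _ _ A sA).
- exact: GE.
- move=> _ _ [x ->] [y ->]; exists (Num.min x y); apply/seteqP.
  by split=> z /=; rewrite !in_itv/= lt_min => /andP.
- exact: fullE.
- by move=> _ [x ->]; exact: ray_integral0.
- move=> S mS S0; have mST := mT _ mS.
  have := fullE; rewrite -(setUv S) Rintegral_setU//; last 2 first.
  + by rewrite setUv.
  + exact/disj_setPCl.
  + by rewrite S0 add0r.
  + exact: measurableC.
- move=> F mF tF F0; have mFT n := mT _ (mF n).
  rewrite /Rintegral integral_bigcup//; last first.
    by apply: intA; exact: bigcupT_measurable.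
  rewrite eseries0// => n _ _.
  rewrite -[LHS]fineK; last by apply: integrable_fin_num => //; exact: intA.
  by rewrite -/(Rintegral _ _ _) F0.
Qed.

(* Carathéodory-measurable sets are approximated from outside by countable
   unions of half-open intervals, on which the integral is already known to
   vanish. *)
Lemma prim0_ae_eq0 f : integrableD f ->
  (forall t, t \in `[a, b] -> prim g f t = 0) -> ae_eq mu D f (fun=> 0).
Proof.
move=> intf f0.
have int1 : mu.-integrable setT (EFin \o (f \_ D)).
  by rewrite -restrict_EFin; apply/(integrable_mkcond _ mD); exact: intf.
have intA (A : set T) : measurable A -> mu.-integrable A (EFin \o (f \_ D)).
  by move=> mA; apply: integrableS int1.
have cara0 (E : set T) : measurable E -> Rintegral mu E (f \_ D) = 0.
  move=> mE; apply/eqP; apply: contraT; rewrite -normr_gt0 => e0.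
  (* The tolerance is the absolute value of the supposedly nonzero integral over [E]. *)
  have [d [d0 dP]] := integral_normr_continuous int1 e0.
  have muEfin : mu E \is a fin_num.
    rewrite ge0_fin_numE// (@le_lt_trans _ _ (mu setT))//.
      by apply: le_measure; rewrite ?inE.
    by rewrite ltey_eq stieltjes_setT_fin.
  (* The mass of [E] is an infimum over countable covers, so some cover exceeds it by less than
     [d]. *)
  have [_ [A [mA EA] <-] sumA] := lb_ereal_inf_adherent d0 muEfin.
  pose F := \bigcup_k A k.
  have mF : measurable (F : set (measurableTypeR R)).
    by apply: bigcupT_measurable => i; apply: sub_sigma_algebra; exact: mA.
  have mFT : measurable (F : set T) by exact: sub_caratheodory.
  have muF : (mu F < mu E + d%:E)%E.
    apply: le_lt_trans sumA.
    apply: (le_trans (outer_measure_sigma_subadditive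
      ((wlength (right_version g))^*)%mu A)).
    apply: lee_nneseries => // n _.
    by rewrite -((measurable_mu_extE (wlength (right_version g))) (A n)).
  have muFE : (mu (F `\` E) < d%:E)%E.
    rewrite measureD//; last by rewrite (lt_le_trans muF)// leey.
    by rewrite setIidr// lteBlDl.
  have := borel_integral0 intf f0 mF.
  rewrite -(@setDUK _ E F EA) Rintegral_setU//; last 3 first.
  - exact: measurableD.
  - by rewrite (@setDUK _ E F EA); exact: intA.
  - by apply/disj_setPS => x [Ex []].
  (* As the integral over [F] is 0, those over [E] and over its excess in [F] are opposite. The
     excess has mass below [d], so its integral is too small for this. *)
  move=> /eqP; rewrite addr_eq0 => /eqP E0.
  have := dP _ (measurableD mFT mE) muFE; rewrite E0 normrN ltNge.
  by rewrite le_normr_Rintegral//; [exact: measurableD|apply: intA; exact: measurableD].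
have : ae_eq mu D (EFin \o f) (EFin \o (fun=> 0)).
  apply: (integral_ae_eq mD intf); first exact: measurable_cst.
  move=> E ED mE; rewrite [RHS]integral0.
  have <- : (Rintegral mu E (f \_ D))%:E = 0%E by rewrite cara0.
  rewrite /Rintegral fineK; last by apply: integrable_fin_num => //; exact: intA.
  by apply: eq_integral => x /set_mem/ED xD; rewrite /= patchE mem_set.
by apply: filterS => x /= /[apply] -[].
Qed.

(* Let z be the infimum of {b} and the zeros of I w in [t, b].  The interval
   [t, z[ is null, so I w t = I w z.  If I w z were nonzero, z would not be an
   atom, so I w would be right-continuous at z, a limit of zeros. *)
Lemma prim_eq0_of_ae w : integrableD w -> ae_eq mu D (prim g w) (fun=> 0) ->
  prim g w b = 0 -> forall t, t \in `[a, b] -> prim g w t = 0.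
Proof.
move=> intw [N [mN N0 ND]] wb0 t; rewrite in_itv/= => /andP[at_ tb].
have inN x : a <= x -> x < b -> prim g w x != 0 -> N x.
  move=> ax xb /eqP wx; apply: ND => /= h; apply: wx; apply: h.
  by rewrite in_itv/= ax xb.
pose Z := [set x | t <= x <= b /\ prim g w x = 0].
have Zb : Z b by split; rewrite ?tb ?lexx.
have infZ : has_inf Z by split; [exists b | exists t => x [/andP[]]].
have st : t <= inf Z by apply: lb_le_inf; [exists b | move=> x [/andP[]]].
have sb : inf Z <= b by apply: ge_inf => //; exact: infZ.2.
have -> : prim g w t = prim g w (inf Z).
  apply/eqP; rewrite eq_sym -subr_eq0 (prim_sub intw)//; apply/eqP.
  have sub : `[t, inf Z[%classic `<=` D by apply: itv_subD; rewrite ?bnd_simp.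
  have mi : measurable (`[t, inf Z[%classic : set T).
    exact: measurable_stieltjes_itv.
  rewrite /Rintegral null_set_integral//.
    apply: (@measurable_int _ _ _ mu); exact: sub_integrableD sub.
  apply: (subset_measure0 mi mN _ N0) => x /=; rewrite in_itv/= => /andP[tx xs].
  apply: inN; rewrite ?(le_trans at_)// ?(lt_le_trans xs)//.
  apply/eqP => wx; have := xs; rewrite ltNge => /negP; apply.
  by apply: ge_inf; [exact: infZ.2 | split=> //; rewrite tx (le_trans (ltW xs))].
apply/eqP; apply: contraT => ws.
have sltb : inf Z < b.
  by rewrite lt_neqAle sb andbT; apply: contraNneq ws => ->; rewrite wb0.
have as_ : a <= inf Z := le_trans at_ st.
have mus : mu [set inf Z] = 0.
  apply: (subset_measure0 _ mN _ N0); last by move=> _ ->; exact: inN.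
  by rewrite -set_itv1; exact: measurable_stieltjes_itv.
have := prim_cvg_right intw as_ sltb; rewrite primr_prim//.
(* With the value itself as tolerance, no zero can lie within [d] to the right of [inf Z]; the
   definition of the infimum produces one. *)
move=> /cvgrPdist_lt /(_ `|prim g w (inf Z)|); rewrite normr_gt0 ws.
move=> /(_ isT)[d /= d0 dP].
have [z [zb wz] zd] := inf_adherent d0 infZ.
have sz : inf Z <= z by apply: ge_inf; [exact: infZ.2 | split].
have {}sz : inf Z < z.
  by rewrite lt_neqAle sz andbT; apply: contraNneq ws => ->; rewrite wz.
have := dP z; rewrite /= wz subr0 ltxx => -> //.
by rewrite ltr0_norm ?subr_lt0// opprB ltrBlDl.
Qed.

End primitive_uniqueness.

(** * Absolute continuity of primitives, and integration by parts with initial values *)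

Section primitive_absolute_continuity.
Context {R : realType} {a b : R} (g : integrator a b).
Local Notation T := (stieltjes_space g).
Local Notation mu := (stieltjes g).
Local Notation D := (`[a, b[%classic : set R).
Local Notation integrableD f := (mu.-integrable D (EFin \o f)).
Implicit Types (f h w : R -> R) (s t x : R) (A : set R).

Let mD : measurable (D : set T) := measurable_stieltjes_itv g `[a, b[.

(** By disjointness the increments of [g] add up to the mass of the union [F], and those of the
    primitive are bounded in total by the integral of |f| over [F]. *)
Lemma prim_abs_continuous f (e : R) : integrableD f -> 0 < e ->
  exists2 d : R, 0 < d & forall (n : nat) (s t : 'I_n -> R),
    (forall j, [/\ a <= s j, s j < t j & t j <= b]) ->
    trivIset setT (fun j => `[s j, t j[%classic) ->
    \sum_(j < n) (g (t j) - g (s j)) < d ->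
    \sum_(j < n) `|prim g f (t j) - prim g f (s j)| < e.
Proof.
move=> intf e0; have [d d0 dP] := integralD_abs_continuous intf e0.
exists d => // n s t st tI sd.
pose I j : set T := `[s j, t j[%classic.
have mI j : measurable (I j) by exact: measurable_stieltjes_itv.
have subI j : I j `<=` D.
  by have [as_ _ tb] := st j; apply: itv_subD; rewrite ?bnd_simp.
pose F : set T := \big[setU/set0]_(j < n) I j.
have mF : measurable F by exact: bigsetU_measurable.
have subF : F `<=` D.
  by apply: (big_ind (fun X => X `<=` D)) => // X Y XD YD; rewrite subUset.
have muF : (mu F < d%:E)%E.
  rewrite /F measure_bigsetU_ord// (eq_bigr (fun j => (g (t j) - g (s j))%:E)).
    by rewrite sumEFin lte_fin.
  by move=> j _; have [as_ stj tb] := st j; exact: (stieltjes_itv g as_ (ltW stj) tb).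
apply: le_lt_trans (dP F subF mF muF).
have intn : integrableD (fun x => `|f x|) by exact: integrable_norm.
have intnI j : mu.-integrable (I j) (EFin \o (fun x => `|f x|)).
  by apply: integrableS intn.
rewrite -lee_fin -sumEFin /Rintegral fineK; last first.
  by apply: integrable_fin_num => //; apply: integrableS intn.
rewrite /F integral_bigsetU_EFin//; last 3 first.
- exact: index_enum_uniq.
- by apply: sub_trivIset tI.
- by apply: (@measurable_int _ _ _ mu); apply: integrableS intn.
apply: lee_sum => j _; have [as_ stj tb] := st j.
rewrite (prim_sub intf as_ (ltW stj) tb) -[leRHS]fineK; last first.
  by apply: integrable_fin_num => //; exact: intnI.
rewrite lee_fin; apply: (le_normr_Rintegral (mI j)).
exact: sub_integrableD intf (subI j).
Qed.

Lemma integrableD_affine_prim (c : R) f h : integrableD f -> integrableD h ->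
  integrableD (fun x => (c + prim g f x) * h x).
Proof.
move=> intf inth.
have -> : (fun x => (c + prim g f x) * h x) = (fun x => h x * (c + prim g f x)).
  by apply/funext => x; rewrite mulrC.
apply: (@integrableD_mul_bounded _ _ _ _ _ _ (`|c| + Rintegral mu D (fun x => `|f x|)) inth).
  by apply: measurable_funD; [exact: measurable_cst | exact: measurable_prim].
by move=> x xD; rewrite (le_trans (ler_normD _ _))// lerD2l; exact: prim_bound.
Qed.

Lemma integrableD_affine_primr (c : R) f h : integrableD f -> integrableD h ->
  integrableD (fun x => f x * (c + primr g h x)).
Proof.
move=> intf inth.
apply: (@integrableD_mul_bounded _ _ _ _ _ _ (`|c| + Rintegral mu D (fun x => `|h x|)) intf).
  by apply: measurable_funD; [exact: measurable_cst | exact: measurable_primr].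
by move=> x xD; rewrite (le_trans (ler_normD _ _))// lerD2l; exact: primr_bound.
Qed.

(** The constants contribute [c * prim g h b + d * prim g f b], which completes the product of the
    primitives at [b] to the product of final values minus that of initial values. *)
Lemma affine_prim_by_parts (c d : R) f h : integrableD f -> integrableD h ->
  Rintegral mu D (fun x => (c + prim g f x) * h x) +
  Rintegral mu D (fun x => f x * (d + primr g h x)) =
  (c + prim g f b) * (d + prim g h b) - c * d.
Proof.
move=> intf inth.
have i1 : integrableD (fun x => c * h x).
  have -> : EFin \o (fun x => c * h x) = (fun x => c%:E * (h x)%:E)%E by [].
  exact: integrableZl.
have i2 : integrableD (fun x => prim g f x * h x).
  have := integrableD_affine_prim 0 intf inth.
  by congr (_.-integrable _ _); apply/funext => x /=; rewrite add0r.
have i3 : integrableD (fun x => d * f x).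
  have -> : EFin \o (fun x => d * f x) = (fun x => d%:E * (f x)%:E)%E by [].
  exact: integrableZl.
have i4 : integrableD (fun x => f x * primr g h x).
  have := integrableD_affine_primr 0 intf inth.
  by congr (_.-integrable _ _); apply/funext => x /=; rewrite add0r.
under eq_Rintegral do rewrite mulrDl.
under [X in _ + X]eq_Rintegral do rewrite mulrDr [_ * d]mulrC.
rewrite RintegralD// RintegralD// RintegralZl// RintegralZl//.
rewrite -[Rintegral mu D h]/(prim g h b) -[Rintegral mu D f]/(prim g f b).
by rewrite mulrDl !mulrDr -(prim_by_parts intf inth); ring.
Qed.

End primitive_absolute_continuity.

(** * Real and complex scalars *)

Section scalar_parts.
Context {R : realType} {k : scalar_kind}.
Local Notation K := (scalar_field R k).
Implicit Types (y z : K).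

Lemma reim_inj y z : re y = re z -> im y = im z -> y = z.
Proof. by case: k y z => //= -[y1 y2] [z1 z2] /= -> ->. Qed.

Lemma reD y z : re (y + z) = re y + re z.
Proof. by case: k y z => //= -[? ?] []. Qed.

Lemma imD y z : im (y + z) = im y + im z.
Proof. by case: k y z => [y z|[? ?] []//]; rewrite /= addr0. Qed.

Lemma reN z : re (- z) = - re z.
Proof. by case: k z => //= -[]. Qed.

Lemma imN z : im (- z) = - im z.
Proof. by case: k z => [z|[]//]; rewrite /= oppr0. Qed.

Lemma reM y z : re (y * z) = re y * re z - im y * im z.
Proof. by case: k y z => [y z|[? ?] []//]; rewrite /= mul0r subr0. Qed.

Lemma imM y z : im (y * z) = re y * im z + im y * re z.
Proof. by case: k y z => [y z|[? ?] []//]; rewrite /= mulr0 mul0r addr0. Qed.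

Lemma re0 : re (0 : K) = 0. Proof. by case: k. Qed.
Lemma im0 : im (0 : K) = 0. Proof. by case: k. Qed.

Lemma re_real (x : R) : re (of_parts k x 0) = x. Proof. by case: k. Qed.
Lemma im_real (x : R) : im (of_parts k x 0) = 0. Proof. by case: k. Qed.

Lemma modulusE z : modulus z = Num.sqrt (re z ^+ 2 + im z ^+ 2).
Proof.
case: k z => z; rewrite /modulus; last by rewrite normc_def.
by rewrite /= expr0n addr0 sqrtr_sqr.
Qed.

Lemma modulus_ge0 z : 0 <= modulus z.
Proof. by rewrite modulusE sqrtr_ge0. Qed.

Lemma normr_re_le z : `|re z| <= modulus z.
Proof. by rewrite modulusE -sqrtr_sqr ler_wsqrtr// lerDl sqr_ge0. Qed.

Lemma normr_im_le z : `|im z| <= modulus z.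
Proof. by rewrite modulusE -sqrtr_sqr ler_wsqrtr// lerDr sqr_ge0. Qed.

Lemma modulus_le z : modulus z <= `|re z| + `|im z|.
Proof.
rewrite modulusE -[leRHS]ger0_norm ?addr_ge0// -sqrtr_sqr ler_wsqrtr//.
rewrite sqrrD !real_normK ?num_real// lerD2r lerDl.
by rewrite mulrn_wge0// mulr_ge0.
Qed.

(** In the complex case 0 < e forces [e] to be real, so the comparison in [K] reduces to one of real
    parts. *)
Lemma ltr_norm_modulus z (e : K) : 0 < e -> modulus z < re e -> `|z| < e.
Proof.
case: k z e => //= z e; rewrite /modulus/= normc_def !ltcE/=.
by move=> /andP[/eqP -> _]; case: z => x y; rewrite /= eqxx.
Qed.

Lemma re_gt0 (e : K) : 0 < e -> 0 < re e.
Proof. by case: k e => //= e; rewrite ltcE/= => /andP[]. Qed.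

(** Tolerances in [K] are scalars; each part is given half of the real number [re e]. *)
Lemma cvg_scalar {X : Type} (F : set_system X) {FF : Filter F} (u : X -> K) (l : K) :
  re (u x) @[x --> F] --> re l -> im (u x) @[x --> F] --> im l ->
  u x @[x --> F] --> l.
Proof.
move=> /cvgrPdist_lt ure /cvgrPdist_lt uim; apply/cvgrPdist_lt => e e0.
have e2 : 0 < re e / 2 by rewrite divr_gt0// re_gt0.
near=> x; apply: ltr_norm_modulus => //.
apply: le_lt_trans (modulus_le _) _; rewrite reD imD reN imN [ltRHS]splitr.
by apply: ltrD; near: x; [exact: ure | exact: uim].
Unshelve. all: by end_near. Qed.

End scalar_parts.

(** * Lebesgue spaces of scalar functions and almost-everywhere equality *)

Section lebesgue_spaces.
Context {R : realType} {a b : R} (g : integrator a b) {k : scalar_kind}.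
Local Notation T := (stieltjes_space g).
Local Notation mu := (stieltjes g).
Local Notation K := (scalar_field R k).
Local Notation D := (`[a, b[%classic : set R).
Local Notation integrableD f := (mu.-integrable D (EFin \o f)).
Implicit Types (u v psi : R -> K) (p q : \bar R).

Let mD : measurable (D : set T) := measurable_stieltjes_itv g `[a, b[.

Lemma re_scalar_integral (A : set R) u :
  re (scalar_integral g A u) = Rintegral mu A (fun t => re (u t)).
Proof. by rewrite /scalar_integral; case: k u. Qed.

Lemma im_scalar_integral (A : set R) u :
  im (scalar_integral g A u) = Rintegral mu A (fun t => im (u t)).
Proof.
rewrite /scalar_integral; case: k u => //= u.
by rewrite /Rintegral integral0.
Qed.

Lemma measurable_modulus u :
  measurable_fun (D : set T) (fun t => re (u t)) ->
  measurable_fun (D : set T) (fun t => im (u t)) ->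
  measurable_fun (D : set T) (fun t => modulus (u t)).
Proof.
move=> mre mim.
have -> : (fun t => modulus (u t)) = Num.sqrt \o (fun t => re (u t) ^+ 2 + im (u t) ^+ 2).
  by apply/funext => t; rewrite /= modulusE.
apply: measurableT_comp.
  by apply: nondecreasing_measurable => // x y; exact: ler_wsqrtr.
by apply: measurable_funD; exact: measurable_funX.
Qed.

(** Membership is transferred to the modulus extended by 0, so that results on [Lfun] apply. *)
Lemma Lp_Lfun p u : Lp g p u <->
  [/\ measurable_fun (D : set T) (fun t => re (u t)),
      measurable_fun (D : set T) (fun t => im (u t)) &
      ((fun t => modulus (u t)) \_ D : T -> R) \in Lfun mu p].
Proof.
have nE : ((fun t => (modulus (u t))%:E) \_ D = EFin \o ((fun t => modulus (u t)) \_ D))%E.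
  by rewrite -restrict_EFin.
split=> [[mre mim]|[mre mim]].
  rewrite nE => fin; split; [exact: mre | exact: mim |].
  rewrite inE; apply/andP; split; rewrite inE//=.
  exact/(measurable_restrictT _ mD).1/measurable_modulus.
rewrite inE => /andP[_ /[!inE]]; rewrite /= /finite_norm => fin.
by split=> //; rewrite nE.
Qed.

(** The total mass is finite, so a larger exponent is the stronger condition. *)
Lemma Lp_sub p q u : a <= b -> (1 <= p)%E -> (p <= q)%E -> Lp g q u -> Lp g p u.
Proof.
move=> ab p1 pq /Lp_Lfun[mre mim uL]; apply/Lp_Lfun; split=> //.
apply: (@Lfun_subset _ _ _ mu p q) => //; first exact: le_trans pq.
exact: stieltjes_setT_fin.
Qed.

Lemma bounded_Lp p u (C : R) : a <= b -> (1 <= p)%E ->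
  measurable_fun (D : set T) (fun t => re (u t)) ->
  measurable_fun (D : set T) (fun t => im (u t)) ->
  (forall t, t \in D -> modulus (u t) <= C) -> Lp g p u.
Proof.
move=> ab p1 mre mim uC; apply: (@Lp_sub p +oo%E) => //; first exact: leey.
split=> //; rewrite unlock /Lnorm; case: ifPn => // _.
(* The absolute value makes the bound valid off [D] too, where the extension is 0. *)
apply: (@le_lt_trans _ _ `|C|%:E); last exact: ltry.
apply/ess_supP/nearW => t; rewrite /= patchE; case: ifPn => tD; last first.
  by rewrite abse0 lee_fin.
by rewrite /= lee_fin ger0_norm ?modulus_ge0// (le_trans (uC _ tD))// ler_norm.
Qed.

Lemma Lp1_integrable u : Lp g 1 u ->
  integrableD (fun t => re (u t)) /\ integrableD (fun t => im (u t)).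
Proof.
move=> /Lp_Lfun[mre mim /Lfun1_integrable].
rewrite -restrict_EFin => /(integrable_mkcond _ mD) int.
split; apply: (le_integrable mD _ _ int).
- exact/measurable_EFinP.
- by move=> t _; rewrite /= lee_fin (ger0_norm (modulus_ge0 _)) normr_re_le.
- exact/measurable_EFinP.
- by move=> t _; rewrite /= lee_fin (ger0_norm (modulus_ge0 _)) normr_im_le.
Qed.

Lemma ae_eq_Rintegral (A : set R) (f h : R -> R) : measurable (A : set T) -> A `<=` D ->
  measurable_fun (D : set T) f -> measurable_fun (D : set T) h ->
  ae_eq mu D f h -> Rintegral mu A f = Rintegral mu A h.
Proof.
move=> mA AD mf mh fh; rewrite /Rintegral; congr fine; apply: ae_eq_integral.
- exact: mA.
- by apply/measurable_EFinP; exact: measurable_funS mf.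
- by apply/measurable_EFinP; exact: measurable_funS mh.
- by apply: filterS fh => x + /AD xD => /(_ xD) ->.
Qed.

Lemma ae_eq_scalar_integral u v :
  measurable_fun (D : set T) (fun t => re (u t)) ->
  measurable_fun (D : set T) (fun t => im (u t)) ->
  measurable_fun (D : set T) (fun t => re (v t)) ->
  measurable_fun (D : set T) (fun t => im (v t)) ->
  ae_equal g u v -> forall t, t <= b ->
  scalar_integral g `[a, t[%classic u = scalar_integral g `[a, t[%classic v.
Proof.
move=> mru miu mrv miv uv t tb.
have sub : `[a, t[%classic `<=` D by apply: subset_itvl; rewrite bnd_simp.
have mt : measurable (`[a, t[%classic : set T) by exact: measurable_stieltjes_itv.
apply: reim_inj.
  rewrite !re_scalar_integral; apply: (ae_eq_Rintegral mt sub mru mrv).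
  by apply: filterS uv => x h xD; rewrite h.
rewrite !im_scalar_integral; apply: (ae_eq_Rintegral mt sub miu miv).
by apply: filterS uv => x h xD; rewrite h.
Qed.

Lemma ae_equal_reim u v :
  ae_eq mu D (fun t => re (u t)) (fun t => re (v t)) ->
  ae_eq mu D (fun t => im (u t)) (fun t => im (v t)) -> ae_equal g u v.
Proof.
by apply: filterS2 => t rt it tD; apply: reim_inj; [exact: rt | exact: it].
Qed.

End lebesgue_spaces.

(** * The weak formulation *)

Section weak_formulation.
Context {R : realType} {a b : R} (ab : a < b) (g : integrator a b) {k : scalar_kind}.
Local Notation T := (stieltjes_space g).
Local Notation mu := (stieltjes g).
Local Notation K := (scalar_field R k).
Local Notation D := (`[a, b[%classic : set R).
Local Notation integrableD f := (mu.-integrable D (EFin \o f)).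
Implicit Types (u v phi psi U : R -> K) (p : \bar R).

Let mD : measurable (D : set T) := measurable_stieltjes_itv g `[a, b[.

Lemma derivative_re U v : is_stieltjes_derivative g U v -> forall t, t \in `[a, b] ->
  re (U t) = re (U a) + prim g (fun x => re (v x)) t.
Proof. by move=> [_ UE] t /UE ->; rewrite reD re_scalar_integral. Qed.

Lemma derivative_im U v : is_stieltjes_derivative g U v -> forall t, t \in `[a, b] ->
  im (U t) = im (U a) + prim g (fun x => im (v x)) t.
Proof. by move=> [_ UE] t /UE ->; rewrite imD im_scalar_integral. Qed.

Let subcc t : t \in D -> t \in `[a, b].
Proof. by rewrite inE/= !in_itv/= => /andP[-> /ltW]. Qed.

Let b_in : b \in `[a, b]. Proof. by rewrite in_itv/= (ltW ab) lexx. Qed.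

Lemma derivative_measurable_re U v : is_stieltjes_derivative g U v ->
  measurable_fun (D : set T) (fun t => re (U t)).
Proof.
move=> Uv; have [ire _] := Lp1_integrable Uv.1.
apply: (@eq_measurable_fun _ _ T _ _
  (fun t : T => re (U a) + prim g (fun x => re (v x)) t)).
  by move=> t /subcc tab; rewrite (derivative_re Uv tab).
by apply: measurable_funD; [exact: measurable_cst | exact: measurable_prim].
Qed.

Lemma derivative_measurable_im U v : is_stieltjes_derivative g U v ->
  measurable_fun (D : set T) (fun t => im (U t)).
Proof.
move=> Uv; have [_ iim] := Lp1_integrable Uv.1.
apply: (@eq_measurable_fun _ _ T _ _
  (fun t : T => im (U a) + prim g (fun x => im (v x)) t)).
  by move=> t /subcc tab; rewrite (derivative_im Uv tab).
by apply: measurable_funD; [exact: measurable_cst | exact: measurable_prim].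
Qed.

(** Each part of [U] is bounded by its initial value plus the norm of its derivative, and bounded
    measurable functions lie in every space with exponent at least 1. *)
Lemma derivative_Lp p U v : (1 <= p)%E -> is_stieltjes_derivative g U v -> Lp g p U.
Proof.
move=> p1 Uv; have [ire iim] := Lp1_integrable Uv.1.
apply: (@bounded_Lp _ _ _ g k p U
  (`|re (U a)| + Rintegral mu D (fun x => `|re (v x)|) +
  (`|im (U a)| + Rintegral mu D (fun x => `|im (v x)|)))).
- exact: ltW.
- exact: p1.
- exact: derivative_measurable_re Uv.
- exact: derivative_measurable_im Uv.
move=> t tD; apply: le_trans (modulus_le _) _.
rewrite (derivative_re Uv (subcc tD)) (derivative_im Uv (subcc tD)).
by apply: lerD; apply: le_trans (ler_normD _ _) _; rewrite lerD2l; exact: prim_bound.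
Qed.

Lemma derivative_AC U v : is_stieltjes_derivative g U v -> Defs.AC g U.
Proof.
move=> Uv e e0; have [ire iim] := Lp1_integrable Uv.1.
have e2 : 0 < e / 2 by rewrite divr_gt0.
have [d1 d10 P1] := prim_abs_continuous ire e2.
have [d2 d20 P2] := prim_abs_continuous iim e2.
exists (Num.min d1 d2); first by rewrite lt_min d10.
move=> n s t st tI; rewrite lt_min => /andP[/(P1 _ _ _ st tI) S1 /(P2 _ _ _ st tI) S2].
rewrite [ltRHS]splitr; apply: le_lt_trans (ltrD S1 S2); rewrite -big_split/=.
apply: ler_sum => j _; have [as_ stj tb] := st j.
have sI : s j \in `[a, b] by rewrite in_itv/= as_ (le_trans (ltW stj)).
have tI' : t j \in `[a, b] by rewrite in_itv/= tb (le_trans as_)// ltW.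
apply: le_trans (modulus_le _) _; rewrite reD reN imD imN.
rewrite (derivative_re Uv sI) (derivative_re Uv tI').
rewrite (derivative_im Uv sI) (derivative_im Uv tI').
have cancel (c p q : R) : c + p - (c + q) = p - q by ring.
by rewrite !cancel.
Qed.

(** Every [t, x[ contains [t], so g(x) - g(t) is at least the mass of [t], and this survives the
    limit. Contrapositively, points of [a, b[ off the jump set carry no mass. *)
Lemma jump_gt0 t : a <= t -> t < b -> mu [set t] != 0 -> t \in jump_set g.
Proof.
move=> at_ tb mut; rewrite inE /jump_set/= at_ tb; split=> //.
have mt : measurable ([set t] : set T).
  by rewrite -set_itv1; exact: measurable_stieltjes_itv.
have mufin : mu [set t] \is a fin_num.
  rewrite ge0_fin_numE// (@le_lt_trans _ _ (mu setT))//.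
    by apply: le_measure; rewrite ?inE.
  by rewrite ltey_eq stieltjes_setT_fin// ltW.
have mugt0 : 0 < fine (mu [set t]).
  by rewrite lt_neqAle fine_ge0// andbT eq_sym fine_eq0.
have gmono s x : a <= s -> s <= x -> x <= b -> g s <= g x.
  move=> as_ sx xb; apply: integrator_nondecreasing => //.
    by rewrite in_itv/= as_ (le_trans sx).
  by rewrite in_itv/= xb (le_trans as_).
(* [lim] is meaningful only under convergence, which holds because [g] is nondecreasing and bounded
   below by g(t) to the right of [t]. *)
have cg : cvg (g s @[s --> t^'+]).
  apply: nondecreasing_at_right_is_cvgr.
    near=> x; move=> r s; rewrite !in_itv/= => /andP[tr rx] /andP[ts sx] rs.
    apply: gmono => //; first by rewrite (le_trans at_)// ltW.
    rewrite (le_trans (ltW sx))//; near: x; exact: nbhs_right_le.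
  near=> x; exists (g t) => y [s /=]; rewrite in_itv/= => /andP[ts sx] <-.
  apply: gmono => //; first exact: ltW.
  rewrite (le_trans (ltW sx))//; near: x; exact: nbhs_right_le.
rewrite /jump subr_gt0; apply: (@lt_le_trans _ _ (g t + fine (mu [set t]))).
  by rewrite ltrDl.
apply: limr_ge => //; near=> x.
have tx : t < x by near: x; exact: nbhs_right_gt.
have xb : x <= b by near: x; exact: nbhs_right_le.
rewrite -lerBrDl -lee_fin fineK// -(stieltjes_itv g at_ (ltW tx) xb).
apply: le_measure; rewrite ?inE//; first exact: measurable_stieltjes_itv.
by move=> _ ->; rewrite /= in_itv/= lexx.
Unshelve. all: by end_near. Qed.

(** At a jump the right limit of [prim] is [primr]; elsewhere the point is null and the two
    coincide. Both branches of the trace thus give one formula. *)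
Lemma posterior_traceE phi psi t : is_stieltjes_derivative g phi psi -> t \in D ->
  re (posterior_trace g phi t) = re (phi a) + primr g (fun x => re (psi x)) t /\
  im (posterior_trace g phi t) = im (phi a) + primr g (fun x => im (psi x)) t.
Proof.
move=> Dphi tD; have [ire iim] := Lp1_integrable Dphi.1.
have tab := subcc tD; move: (tD); rewrite inE/= in_itv/= => /andP[at_ tb].
rewrite /posterior_trace; case: ifPn => [_|tJ]; last first.
  have mut : mu [set t] = 0 by apply/eqP; apply: contraNT tJ; exact: jump_gt0.
  by rewrite (derivative_re Dphi tab) (derivative_im Dphi tab) !primr_prim.
pose l : K := phi a + scalar_integral g `[a, t]%classic psi.
have rel : re l = re (phi a) + primr g (fun x => re (psi x)) t.
  by rewrite reD re_scalar_integral.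
have iml : im l = im (phi a) + primr g (fun x => im (psi x)) t.
  by rewrite imD im_scalar_integral.
suff -> : lim (phi s @[s --> t^'+]) = l by [].
apply: cvg_lim; first exact: norm_hausdorff.
have nearE : \forall s \near t^'+, s \in `[a, b].
  near=> s; rewrite in_itv/=; apply/andP; split; last by near: s; exact: nbhs_right_le.
  by rewrite (le_trans at_)//; near: s; exact: nbhs_right_ge.
apply: cvg_scalar.
  rewrite rel; apply: cvg_trans (cvgD (cvg_cst (re (phi a))) (prim_cvg_right ire at_ tb)).
  by apply: near_eq_cvg; apply: filterS nearE => s sab; rewrite (derivative_re Dphi sab).
rewrite iml; apply: cvg_trans (cvgD (cvg_cst (im (phi a))) (prim_cvg_right iim at_ tb)).
by apply: near_eq_cvg; apply: filterS nearE => s sab; rewrite (derivative_im Dphi sab).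
Unshelve. all: by end_near. Qed.

(** Expanding products into real and imaginary parts gives four real integrations by parts,
    recombined with the signs of complex multiplication. *)
Lemma derivative_by_parts U v phi psi :
  is_stieltjes_derivative g U v -> is_stieltjes_derivative g phi psi ->
  scalar_integral g D (fun t => U t * psi t) +
  scalar_integral g D (fun t => v t * posterior_trace g phi t) =
  U b * phi b - U a * phi a.
Proof.
move=> Uv Dphi; have [vre vim] := Lp1_integrable Uv.1.
have [pre pim] := Lp1_integrable Dphi.1.
have rr := affine_prim_by_parts (re (U a)) (re (phi a)) vre pre.
have ri := affine_prim_by_parts (re (U a)) (im (phi a)) vre pim.
have ir := affine_prim_by_parts (im (U a)) (re (phi a)) vim pre.
have ii := affine_prim_by_parts (im (U a)) (im (phi a)) vim pim.
have := derivative_re Uv b_in; have := derivative_im Uv b_in.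
have := derivative_re Dphi b_in; have := derivative_im Dphi b_in.
move=> pbi pbr ubi ubr.
apply: reim_inj; rewrite !(reD, imD, reN, imN, reM, imM) ?re_scalar_integral ?im_scalar_integral.
  rewrite ubr ubi pbr pbi.
  rewrite (@eq_Rintegral _ _ _ mu D (fun t =>
     (re (U a) + prim g (fun x => re (v x)) t) * re (psi t) -
     (im (U a) + prim g (fun x => im (v x)) t) * im (psi t))); last first.
    by move=> t /subcc tab; rewrite reM (derivative_re Uv tab) (derivative_im Uv tab).
  rewrite [X in _ + X](@eq_Rintegral _ _ _ mu D (fun t =>
     re (v t) * (re (phi a) + primr g (fun x => re (psi x)) t) -
     im (v t) * (im (phi a) + primr g (fun x => im (psi x)) t))); last first.
    by move=> t tD; rewrite reM !(posterior_traceE Dphi tD).1 !(posterior_traceE Dphi tD).2.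
  rewrite RintegralB//; [|exact: integrableD_affine_prim..].
  rewrite RintegralB//; [|exact: integrableD_affine_primr..].
  by rewrite addrACA -opprD rr ii; ring.
rewrite ubr ubi pbr pbi.
rewrite (@eq_Rintegral _ _ _ mu D (fun t =>
     (re (U a) + prim g (fun x => re (v x)) t) * im (psi t) +
     (im (U a) + prim g (fun x => im (v x)) t) * re (psi t))); last first.
  by move=> t /subcc tab; rewrite imM (derivative_re Uv tab) (derivative_im Uv tab).
rewrite [X in _ + X](@eq_Rintegral _ _ _ mu D (fun t =>
     re (v t) * (im (phi a) + primr g (fun x => im (psi x)) t) +
     im (v t) * (re (phi a) + primr g (fun x => re (psi x)) t))); last first.
  by move=> t tD; rewrite imM !(posterior_traceE Dphi tD).1 !(posterior_traceE Dphi tD).2.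
rewrite RintegralD//; [|exact: integrableD_affine_prim..].
rewrite RintegralD//; [|exact: integrableD_affine_primr..].
by rewrite addrACA ri ir; ring.
Qed.

End weak_formulation.

(** * Reconstruction of the representative from the weak identity *)

Section representability.
Context {R : realType} {a b : R} (ab : a < b) (g : integrator a b) {k : scalar_kind}.
Local Notation T := (stieltjes_space g).
Local Notation mu := (stieltjes g).
Local Notation K := (scalar_field R k).
Local Notation D := (`[a, b[%classic : set R).
Local Notation integrableD f := (mu.-integrable D (EFin \o f)).
Implicit Types (u v phi psi U : R -> K) (p : \bar R) (c ua ub : K).

Let mD : measurable (D : set T) := measurable_stieltjes_itv g `[a, b[.

(** Serves both as the candidate representative, with [c = ua], and as the general form of a test
    function. *)
Definition primitive_from c v t : K := c + scalar_integral g `[a, t[%classic v.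

Lemma primitive_from_a c v : primitive_from c v a = c.
Proof.
rewrite /primitive_from set_itvxx; apply: reim_inj; rewrite ?reD ?imD.
  by rewrite re_scalar_integral Rintegral_set0 addr0.
by rewrite im_scalar_integral Rintegral_set0 addr0.
Qed.

Lemma primitive_from_derivative c v : Lp g 1 v ->
  is_stieltjes_derivative g (primitive_from c v) v.
Proof. by split=> // t _; rewrite primitive_from_a. Qed.

Lemma measurable_scalar_mul u psi :
  measurable_fun (D : set T) (fun t => re (u t)) ->
  measurable_fun (D : set T) (fun t => im (u t)) ->
  measurable_fun (D : set T) (fun t => re (psi t)) ->
  measurable_fun (D : set T) (fun t => im (psi t)) ->
  measurable_fun (D : set T) (fun t => re (u t * psi t)) /\
  measurable_fun (D : set T) (fun t => im (u t * psi t)).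
Proof.
move=> mru miu mrp mip; split.
  rewrite (_ : (fun t => _) = (fun t => re (u t) * re (psi t) - im (u t) * im (psi t))); last first.
    by apply/funext => t; rewrite reM.
  by apply: measurable_funB; exact: measurable_funM.
rewrite (_ : (fun t => _) = (fun t => re (u t) * im (psi t) + im (u t) * re (psi t))); last first.
  by apply/funext => t; rewrite imM.
by apply: measurable_funD; exact: measurable_funM.
Qed.

Lemma derivative_weak p u ua ub U v : Lp g p u -> ae_equal g U u ->
  U a = ua -> U b = ub -> is_stieltjes_derivative g U v ->
  weak_derivative g u ua ub v.
Proof.
move=> Lpu Uu <- <- Uv phi psi _ Dphi.
rewrite -(derivative_by_parts ab Uv Dphi); congr (_ + _).
have [mru miu _] := Lpu; have [mrp mip _] := Dphi.1.
have [mr mi] := measurable_scalar_mul mru miu mrp mip.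
have [mr' mi'] := measurable_scalar_mul (derivative_measurable_re Uv)
  (derivative_measurable_im Uv) mrp mip.
apply: ae_eq_scalar_integral; [exact: mr|exact: mi|exact: mr'|exact: mi'| |exact: lexx].
by apply: filterS Uu => t Ut tD; rewrite Ut.
Qed.

(** Subtracting integration by parts for [primitive_from ua v] from the weak identity cancels the
    posterior-trace terms, and the terms at [a] since both start from [ua]. Only a mismatch at [b]
    remains. *)
Lemma weak_test u ua ub v psi c : Lp g 1 v -> weak_derivative g u ua ub v ->
  Lp g +oo%E psi ->
  scalar_integral g D (fun t => u t * psi t) -
  scalar_integral g D (fun t => primitive_from ua v t * psi t) =
  (ub - primitive_from ua v b) * primitive_from c psi b.
Proof.
move=> Lv wv Lpsi.
have Lpsi1 : Lp g 1 psi by apply: Lp_sub Lpsi => //; [exact: ltW | exact: leey].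
have Dphi := primitive_from_derivative c Lpsi1.
have tphi : test_function g (primitive_from c psi) by exists c, psi.
have := derivative_by_parts ab (primitive_from_derivative ua Lv) Dphi.
have := wv _ _ tphi Dphi; rewrite !primitive_from_a.
set X := scalar_integral _ _ _; set Y := scalar_integral _ _ _.
set Z := scalar_integral _ _ _ => XY ZY.
(* [Y] is the trace term shared by both identities; adding [Y] and then [Z] makes each of them
   applicable. *)
rewrite mulrBl; apply: (addIr Y); rewrite addrAC XY.
by apply: (addIr Z); rewrite subrK -[RHS]addrA [Y + Z]addrC ZY; ring.
Qed.

Lemma bounded_Lpoo psi (C : R) : measurable_fun (D : set T) (fun t => re (psi t)) ->
  measurable_fun (D : set T) (fun t => im (psi t)) ->
  (forall t, modulus (psi t) <= C) -> Lp g +oo%E psi.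
Proof.
move=> mre mim psiC; apply: (bounded_Lp (ltW ab) _ mre mim); first exact: leey.
by move=> t _; exact: psiC.
Qed.

(** The test function is the constant 1, that is [c = 1] and [psi = 0]: the integrals vanish and the
    mismatch at [b] is left alone. *)
Lemma weak_traceE u ua ub v : Lp g 1 v -> weak_derivative g u ua ub v ->
  primitive_from ua v b = ub.
Proof.
move=> Lv wv; have L0 : Lp g +oo%E (fun=> 0 : K).
  apply: (@bounded_Lpoo _ 0).
  - by rewrite re0; exact: measurable_cst.
  - by rewrite im0; exact: measurable_cst.
  - by move=> t; rewrite modulusE re0 im0 expr0n addr0 sqrtr0.
have SI0 A : scalar_integral g A (fun=> 0 : K) = 0.
  apply: reim_inj; rewrite ?re_scalar_integral ?im_scalar_integral /Rintegral.
    by rewrite re0 integral0.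
  by rewrite im0 integral0.
have := weak_test 1 Lv wv L0.
have mul0 (w : R -> K) : (fun t => w t * 0) = (fun=> 0).
  by apply/funext => t; rewrite mulr0.
rewrite !mul0 /primitive_from !SI0 addr0 mulr1 subr0 => /eqP.
by rewrite eq_sym subr_eq0 => /eqP.
Qed.

(** With the values at [b] already matched, testing with the indicator of [E] as derivative shows
    that both functions have the same integral over every measurable [E]. *)
Lemma weak_ae_primitive u ua ub v : Lp g 1 u -> Lp g 1 v ->
  weak_derivative g u ua ub v -> ae_equal g (primitive_from ua v) u.
Proof.
move=> Lu Lv wv; have [iru iiu] := Lp1_integrable Lu.
have LU : Lp g 1 (primitive_from ua v).
  exact: derivative_Lp (primitive_from_derivative ua Lv).
have [irU iiU] := Lp1_integrable LU.
pose ind (E : set R) t : K := of_parts k (\1_E t) 0.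
have indP E : measurable (E : set T) ->
    scalar_integral g D (fun t => u t * ind E t) =
    scalar_integral g D (fun t => primitive_from ua v t * ind E t).
  move=> mE; have LE : Lp g +oo%E (ind E).
    apply: (@bounded_Lpoo _ 1).
    - have -> : (fun t => re (ind E t)) = \1_E by apply/funext => t; rewrite re_real.
      by apply: measurable_funTS; exact: measurable_indic.
    - have -> : (fun t => im (ind E t)) = (fun=> 0) by apply/funext => t; rewrite im_real.
      exact: measurable_cst.
    - move=> t; rewrite modulusE re_real im_real expr0n addr0 sqrtr_sqr.
      by rewrite indicE; case: (_ \in _); rewrite ?normr1 ?normr0.
  (* The initial value 0 is an arbitrary choice: the factor in front of the test function
     vanishes. *)
  have := weak_test 0 Lv wv LE; rewrite (weak_traceE Lv wv) subrr mul0r.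
  by move=> /eqP; rewrite subr_eq0 => /eqP.
have restrict_ind E (f : R -> R) : E `<=` D ->
    Rintegral mu D (fun t => f t * \1_E t) = Rintegral mu E f.
  move=> ED; rewrite -[in RHS](setIidr ED) Rintegral_mkcondr; apply: eq_Rintegral => t _.
  by rewrite patchE indicE; case: ifPn; rewrite ?mulr1 ?mulr0.
have ae_part (f h : R -> R) : integrableD f -> integrableD h ->
    (forall E, measurable (E : set T) -> Rintegral mu D (fun t => f t * \1_E t) =
       Rintegral mu D (fun t => h t * \1_E t)) -> ae_eq mu D f h.
  move=> intf inth fh.
  have : ae_eq mu D (EFin \o f) (EFin \o h).
    apply: (integral_ae_eq mD intf); first exact: measurable_int inth.
    move=> E ED mE; rewrite -[LHS]fineK; last first.
      by apply: integrable_fin_num => //; apply: integrableS intf.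
    rewrite -[RHS]fineK; last first.
      by apply: integrable_fin_num => //; apply: integrableS inth.
    by congr EFin; have := fh E mE; rewrite !restrict_ind.
  by apply: filterS => x /= /[apply] -[].
apply: ae_equal_reim; apply: ae_part => // E mE.
  have /(congr1 (@re R k)) := indP E mE; rewrite !re_scalar_integral => e.
  transitivity (Rintegral mu D (fun t => re (primitive_from ua v t * ind E t))).
    by apply: eq_Rintegral => t _; rewrite reM re_real im_real mulr0 subr0.
  rewrite -e; apply: eq_Rintegral => t _.
  by rewrite reM re_real im_real mulr0 subr0.
have /(congr1 (@im R k)) := indP E mE; rewrite !im_scalar_integral => e.
transitivity (Rintegral mu D (fun t => im (primitive_from ua v t * ind E t))).
  by apply: eq_Rintegral => t _; rewrite imM re_real im_real mulr0 add0r.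
rewrite -e; apply: eq_Rintegral => t _.
by rewrite imM re_real im_real mulr0 add0r.
Qed.

Lemma ae_equal_trans u v psi : ae_equal g u v -> ae_equal g v psi -> ae_equal g u psi.
Proof. by apply: filterS2 => t uv vp tD; rewrite uv// vp. Qed.

Lemma ae_equal_sym u v : ae_equal g u v -> ae_equal g v u.
Proof. by apply: filterS => t uv tD; rewrite uv. Qed.

(** The primitive of f - h vanishes almost everywhere and at [b], hence everywhere, so f - h
    vanishes almost everywhere. The condition at [b] is separate because [D] omits that point. *)
Let prim_diff_ae0 (f h : R -> R) : integrableD f -> integrableD h ->
  ae_eq mu D (prim g f) (prim g h) -> prim g f b = prim g h b -> ae_eq mu D f h.
Proof.
move=> intf inth fh fhb.
have intw : integrableD (fun t => f t - h t).
  have -> : EFin \o (fun t => f t - h t) = ((EFin \o f) \- (EFin \o h))%E by [].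
  exact: integrableB.
have primw t : t <= b -> prim g (fun t => f t - h t) t = prim g f t - prim g h t.
  move=> tb; have sub : `[a, t[%classic `<=` D by apply: subset_itvl; rewrite bnd_simp.
  rewrite /prim RintegralB//; first exact: measurable_stieltjes_itv.
    exact: sub_integrableD intf sub.
  exact: sub_integrableD inth sub.
suff : ae_eq mu D (fun t => f t - h t) (fun=> 0).
  by apply: filterS => t h0 tD; apply/eqP; rewrite -subr_eq0; apply/eqP; exact: h0.
apply: (prim0_ae_eq0 (ltW ab) intw); apply: prim_eq0_of_ae => //.
- apply: filterS fh => t h0 tD; rewrite primw; last first.
    by move: tD; rewrite /= in_itv/= => /andP[_ /ltW].
  by rewrite h0// subrr.
- by rewrite primw// fhb subrr.
Qed.

(** The common initial value cancels, and in each part there remain primitives that agree almost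
    everywhere and at [b]. *)
Lemma derivative_ae_unique U1 U2 v1 v2 : is_stieltjes_derivative g U1 v1 ->
  is_stieltjes_derivative g U2 v2 -> ae_equal g U1 U2 ->
  U1 a = U2 a -> U1 b = U2 b -> ae_equal g v1 v2.
Proof.
move=> D1 D2 U12 Ua Ub.
have [r1 i1] := Lp1_integrable D1.1; have [r2 i2] := Lp1_integrable D2.1.
have b_in : b \in `[a, b] by rewrite in_itv/= (ltW ab) lexx.
have D_in t : D t -> t \in `[a, b] by rewrite /= !in_itv/= => /andP[-> /ltW].
apply: ae_equal_reim; apply: prim_diff_ae0 => //.
- apply: filterS U12 => t h tD; have /(congr1 (@re R k)) := h tD.
  rewrite (derivative_re D1 (D_in _ tD)) (derivative_re D2 (D_in _ tD)) Ua.
  exact: addrI.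
- have /(congr1 (@re R k)) := Ub.
  rewrite (derivative_re D1 b_in) (derivative_re D2 b_in) Ua; exact: addrI.
- apply: filterS U12 => t h tD; have /(congr1 (@im R k)) := h tD.
  rewrite (derivative_im D1 (D_in _ tD)) (derivative_im D2 (D_in _ tD)) Ua.
  exact: addrI.
- have /(congr1 (@im R k)) := Ub.
  rewrite (derivative_im D1 b_in) (derivative_im D2 b_in) Ua; exact: addrI.
Qed.

Lemma ae_equal_derivative U v w : Lp g 1 w -> ae_equal g v w ->
  is_stieltjes_derivative g U v -> is_stieltjes_derivative g U w.
Proof.
move=> Lw vw [Lv UE]; split=> // t tab; rewrite UE//; congr (_ + _).
have [mrv miv _] := Lv; have [mrw miw _] := Lw.
apply: ae_eq_scalar_integral; [exact: mrv|exact: miv|exact: mrw|exact: miw|exact: vw|].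
by move: tab; rewrite in_itv/= => /andP[].
Qed.

End representability.

(** * Equivalence of representatives and weak derivatives, with uniqueness *)

Unset Implicit Arguments.

Theorem corollary4p7 (R : realType) (k : scalar_kind) (a b : R) (ab : a < b)
    (g : integrator a b) (p : \bar R) (p1 : (1 <= p)%E)
    (Mg_gt0 : (0 < total_mass g)%E)
    (u : R -> scalar_field R k) (Lpu : Lp g p u) (ua ub : scalar_field R k) :
  ((exists U, represents g p u ua ub U) <->
   (exists2 v, Lp g p v & weak_derivative g u ua ub v)) /\
  (forall U1 U2, represents g p u ua ub U1 -> represents g p u ua ub U2 ->
     {in `[a, b], U1 =1 U2}) /\
  (forall v1 v2, Lp g p v1 -> weak_derivative g u ua ub v1 ->
     Lp g p v2 -> weak_derivative g u ua ub v2 -> ae_equal g v1 v2) /\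
  (forall U v, represents g p u ua ub U -> Lp g p v ->
     weak_derivative g u ua ub v <-> is_stieltjes_derivative g U v).
Proof.
have L1 (v : R -> scalar_field R k) : Lp g p v -> Lp g 1 v by apply: Lp_sub => //; exact: ltW.
have weak_unique v1 v2 : Lp g p v1 -> weak_derivative g u ua ub v1 ->
    Lp g p v2 -> weak_derivative g u ua ub v2 -> ae_equal g v1 v2.
  move=> /L1 Lv1 w1 /L1 Lv2 w2.
  (* Both primitives started from [ua] equal [u] almost everywhere and reach [ub] at [b]. *)
  apply: (derivative_ae_unique ab (primitive_from_derivative ua Lv1)
    (primitive_from_derivative ua Lv2)); last 2 first.
  - by rewrite !primitive_from_a.
  - by rewrite (weak_traceE ab Lv1 w1) (weak_traceE ab Lv2 w2).
  apply: (ae_equal_trans (weak_ae_primitive ab (L1 _ Lpu) Lv1 w1)).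
  exact: ae_equal_sym (weak_ae_primitive ab (L1 _ Lpu) Lv2 w2).
have weak_of_represents U v : represents g p u ua ub U ->
    is_stieltjes_derivative g U v -> weak_derivative g u ua ub v.
  by move=> [_ Uu Ua Ub] Uv; exact: derivative_weak Lpu Uu Ua Ub Uv.
split; [split|split; [|split]].
- by move=> [U rU]; have [[_ _ [v Uv Lv]] _ _ _] := rU; exists v => //;
    exact: weak_of_represents Uv.
- move=> [v Lv wv]; have Lv1 := L1 _ Lv.
  have Uv := primitive_from_derivative ua Lv1.
  exists (primitive_from g ua v); split.
  + split; [exact: derivative_AC Uv|exact: derivative_Lp Uv|by exists v].
  + exact: weak_ae_primitive (L1 _ Lpu) Lv1 wv.
  + exact: primitive_from_a.
  + exact: weak_traceE Lv1 wv.
- move=> U1 U2 rU1 rU2 t tab.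
  have [[_ _ [v1 Uv1 Lv1]] _ U1a _] := rU1; have [[_ _ [v2 Uv2 Lv2]] _ U2a _] := rU2.
  (* The derivatives of both representatives are weak derivatives of the same traced state, so they
     agree almost everywhere; integrating from the common value [ua] gives equality at every
     point. *)
  have v12 := weak_unique _ _ Lv1 (weak_of_represents _ _ rU1 Uv1)
    Lv2 (weak_of_represents _ _ rU2 Uv2).
  have [_ ->//] := ae_equal_derivative Uv2.1 v12 Uv1.
  by have [_ ->//] := Uv2; rewrite U1a U2a.
- exact: weak_unique.
- move=> U v rU Lv; split; last exact: weak_of_represents.
  (* [U] comes with some derivative [v0]; weak uniqueness identifies it with [v] almost
     everywhere. *)
  move=> wv; have [[_ _ [v0 Uv0 Lv0]] _ _ _] := rU.
  have v0v := weak_unique _ _ Lv0 (weak_of_represents _ _ rU Uv0) Lv wv.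
  exact: ae_equal_derivative (L1 _ Lv) v0v Uv0.
Qed.
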